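(* The function $g(u)=K_{1/2}'(u)/K_{1/2}(u)^2$, $u>0$, satisfies $g'(u)>0$ on $\bigl(0,\tfrac{\sqrt2-1}{2}\bigr)$ and $g'(u)<0$ on $\bigl(\tfrac{\sqrt2-1}{2},\infty\bigr)$; its unique critical point $u=(\sqrt2-1)/2$ is a strict global maximum.
   Context: $K_{1/2}$ is the modified Bessel function of the second kind of order $1/2$, given by $K_{1/2}(u)=\sqrt{\frac{\pi}{2u}}\,e^{-u}$ for $u>0$. *)

(* Defs.v *)
From Stdlib Require Import Reals.
From Coquelicot Require Import Coquelicot.
Open Scope R_scope.

(* Modified Bessel function of the second kind of order 1/2, in its closed
   form on u > 0; values at u <= 0 carry no meaning. *)
Definition K_half (u : R) : R := sqrt (PI / (2 * u)) * exp (- u).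

Definition g (u : R) : R := Derive K_half u / (K_half u) ^ 2.

Definition u_star : R := (sqrt 2 - 1) / 2.

(* Main.v *)
Require Import Defs.
From Stdlib Require Import Reals Lra.
From Coquelicot Require Import Coquelicot.
Open Scope R_scope.

(** Write [K] for [K_half] and [w u = 1 + 1 / (2 u)].  The logarithmic
    derivative of [u^(-1/2) e^(-u)] is [- w], so [K' = - w K] and the quotient
    [g = K' / K^2] collapses to [- w / K].  Differentiating this and using
    [K' = - w K] once more, the exponential and the square root survive only
    as the positive factor [1 / K]:
    [g' = (- w' - w^2) / K = (2 - (2 u + 1)^2) / (4 u^2 K)]
    (lemma [is_derive_g]).  The sign of [g'] is therefore that of
    [2 - (2 u + 1)^2], and [u_star] is precisely the point where
    [2 u + 1 = sqrt 2].  Strict maximality follows from these signs by the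
    mean value theorem on the segment between [u] and [u_star]. *)

Lemma K_half_pos (u : R) : 0 < u -> 0 < K_half u.
Proof.
intros Hu; unfold K_half.
apply Rmult_lt_0_compat; [apply sqrt_lt_R0 | apply exp_pos].
apply Rdiv_lt_0_compat; [apply PI_RGT_0 | lra].
Qed.

(** The equation [K' = - (1 + 1 / (2 u)) K] is all that is used about [K]
    from here on, besides its positivity. *)
Lemma is_derive_K_half (u : R) :
  0 < u -> is_derive K_half u (- (1 + / (2 * u)) * K_half u).
Proof.
intros Hu.
assert (Hq : 0 < PI / (2 * u))
  by (apply Rdiv_lt_0_compat; [apply PI_RGT_0 | lra]).
assert (Hs := sqrt_lt_R0 _ Hq).
assert (Hss := sqrt_sqrt _ (Rlt_le _ _ Hq)).
unfold K_half; auto_derive.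
- split; [lra | split; [exact Hq | exact I]].
- change (PI * / (2 * u)) with (PI / (2 * u)).
  set (s := sqrt (PI / (2 * u))) in *.
  (* Eliminating PI turns the identity into a rational one in [u] and [s]. *)
  assert (HPI : PI = s * s * (2 * u)) by (rewrite Hss; field; lra).
  rewrite HPI; field; lra.
Qed.

Lemma g_closed_form (u : R) : 0 < u -> g u = - (1 + / (2 * u)) / K_half u.
Proof.
intros Hu; unfold g.
rewrite (is_derive_unique _ _ _ (is_derive_K_half u Hu)).
assert (HK := K_half_pos u Hu); field; lra.
Qed.

Lemma is_derive_g (u : R) :
  0 < u ->
  is_derive g u ((2 - (2 * u + 1) ^ 2) / (4 * u ^ 2 * K_half u)).
Proof.
intros Hu.
assert (HK := K_half_pos u Hu).
assert (HdK := is_derive_K_half u Hu).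
(* The closed form of [g] holds on the whole neighbourhood [0 < v] of [u]. *)
apply (is_derive_ext_loc (fun v => - (1 + / (2 * v)) / K_half v)).
- apply (filter_imp (fun v => 0 < v)).
  + intros v Hv; symmetry; exact (g_closed_form v Hv).
  + exact (open_gt 0 u Hu).
- auto_derive.
  + repeat split; try lra; eexists; exact HdK.
  + change (fun x => K_half x) with K_half.
    rewrite (is_derive_unique _ _ _ HdK); field; lra.
Qed.

Lemma Derive_g (u : R) :
  0 < u -> Derive g u = (2 - (2 * u + 1) ^ 2) / (4 * u ^ 2 * K_half u).
Proof. intros Hu; exact (is_derive_unique _ _ _ (is_derive_g u Hu)). Qed.

Lemma Derive_g_denominator_pos (u : R) :
  0 < u -> 0 < 4 * u ^ 2 * K_half u.
Proof.
intros Hu; apply Rmult_lt_0_compat; [nra | exact (K_half_pos u Hu)].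
Qed.

(** The defining property of the critical point: it is where the numerator of
    [g'] vanishes. *)
Lemma u_star_root : (2 * u_star + 1) ^ 2 = 2.
Proof.
assert (Hs := sqrt_sqrt 2 ltac:(lra)); unfold u_star; nra.
Qed.

Lemma u_star_pos : 0 < u_star.
Proof.
assert (H := sqrt_lt_1 1 2 ltac:(lra) ltac:(lra) ltac:(lra)).
rewrite sqrt_1 in H; unfold u_star; lra.
Qed.

Lemma Derive_g_pos (u : R) : 0 < u < u_star -> 0 < Derive g u.
Proof.
intros [Hu Hlt]; rewrite (Derive_g u Hu).
assert (Hroot := u_star_root).
apply Rdiv_lt_0_compat; [nra | exact (Derive_g_denominator_pos u Hu)].
Qed.

Lemma Derive_g_neg (u : R) : u_star < u -> Derive g u < 0.
Proof.
intros Hlt; assert (Hs := u_star_pos); assert (Hroot := u_star_root).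
assert (Hu : 0 < u) by lra.
rewrite (Derive_g u Hu).
apply Rdiv_neg_pos; [nra | exact (Derive_g_denominator_pos u Hu)].
Qed.

Lemma Derive_g_eq0 (u : R) : 0 < u -> (Derive g u = 0 <-> u = u_star).
Proof.
intros Hu; split.
- intros H0; destruct (Rtotal_order u u_star) as [Hlt | [Heq | Hgt]].
  + assert (H := Derive_g_pos u (conj Hu Hlt)); lra.
  + exact Heq.
  + assert (H := Derive_g_neg u Hgt); lra.
- intros ->; rewrite (Derive_g _ u_star_pos), u_star_root.
  unfold Rdiv; ring.
Qed.

(** The intermediate point is strictly inside the segment, so that the strict
    signs of [g'] on either side of [u_star] apply to it even when [u_star] is
    an endpoint. *)
Lemma g_mean_value (a b : R) :
  0 < a -> a < b ->
  exists c, g b - g a = Derive g c * (b - a) /\ a < c < b.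
Proof.
intros Ha Hab; apply (MVT_cor2 g (Derive g) a b Hab).
intros c Hc; apply is_derive_Reals, Derive_correct.
eexists; apply is_derive_g; lra.
Qed.

Lemma g_lt_g_u_star (u : R) : 0 < u -> u <> u_star -> g u < g u_star.
Proof.
intros Hu Hne.
destruct (Rdichotomy _ _ Hne) as [Hlt | Hgt].
- destruct (g_mean_value u u_star Hu Hlt) as [c [Heq Hc]].
  assert (H := Derive_g_pos c ltac:(lra)); nra.
- destruct (g_mean_value u_star u u_star_pos Hgt) as [c [Heq Hc]].
  assert (H := Derive_g_neg c ltac:(lra)); nra.
Qed.

Theorem proposition5p2 :
  (forall u : R, 0 < u -> ex_derive K_half u /\ ex_derive g u) /\
  (forall u : R, 0 < u < u_star -> 0 < Derive g u) /\
  (forall u : R, u_star < u -> Derive g u < 0) /\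
  0 < u_star /\
  (forall u : R, 0 < u -> (Derive g u = 0 <-> u = u_star)) /\
  (forall u : R, 0 < u -> u <> u_star -> g u < g u_star).
Proof.
split; [| split; [| split; [| split; [| split]]]].
- intros u Hu; split; eexists;
    [exact (is_derive_K_half u Hu) | exact (is_derive_g u Hu)].
- exact Derive_g_pos.
- exact Derive_g_neg.
- exact u_star_pos.
- exact Derive_g_eq0.
- exact g_lt_g_u_star.
Qed.
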